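(* Let $d \ge 4$ be a fixed integer. Then, as $s \to \infty$, $$R_{D}(s,s,d) \ge 2^{\left(\frac{1}{2[d/2]} - o(1)\right)s},$$ where $o(1)$ denotes a function of $s$ (depending on $d$) tending to $0$ as $s\to\infty$.
   Context: $[x]$ denotes the integer part of $x$. A graph $G$ is a (unit) distance graph in $\mathbb{R}^d$ if $V(G) \subseteq \mathbb{R}^d$ and $E(G) \subseteq \{\{x,y\} : x,y\in V(G),\ |x-y|=1\}$ (not all unit-distance pairs need be edges). The distance Ramsey number $R_{D}(s,t,d)$ is the minimum natural number $n$ such that for any graph $G$ on $n$ vertices, either $G$ contains an induced $s$-vertex subgraph isomorphic to a distance graph in $\mathbb{R}^d$, or the complement $\bar G$ contains an induced $t$-vertex subgraph isomorphic to a distance graph in $\mathbb{R}^d$. *)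

(* Defs.v *)
From mathcomp Require Export all_boot all_order all_algebra.
From mathcomp Require Export all_classical all_reals all_analysis.
Export numFieldNormedType.Exports.

Set Implicit Arguments.
Unset Strict Implicit.
Unset Printing Implicit Defensive.

Import Order.TTheory GRing.Theory Num.Theory.
Local Open Scope classical_set_scope.
Local Open Scope ring_scope.

(* The norm that the library puts on ['rV[R]_d] is the sup norm, hence a
   separate Euclidean distance. *)
Definition edist (R : realType) (d : nat) (x y : 'rV[R]_d) : R :=
  Num.sqrt (\sum_(i < d) (x 0 i - y 0 i) ^+ 2).

Definition simple_graph (T : Type) (e : rel T) : Prop :=
  symmetric e /\ irreflexive e.

Definition compl_graph (T : eqType) (e : rel T) : rel T :=
  [rel x y | (x != y) && ~~ e x y].

(* A graph with vertex set [V] in R^d; [E] is [false] outside [V], and it need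
   not contain all the unit-distance pairs.  Irreflexivity of [E] is implied. *)
Definition distance_graph (R : realType) (d : nat)
    (V : set 'rV[R]_d) (E : rel 'rV[R]_d) : Prop :=
  symmetric E /\ forall x y, E x y -> [/\ V x, V y & edist x y = 1].

Definition induced_isomorphic (T : finType) (e : rel T) (A : {set T})
    (U : Type) (V : set U) (E : rel U) : Prop :=
  exists f : T -> U,
    set_bij [set` A] V f /\ {in A &, forall x y, e x y = E (f x) (f y)}.

Definition has_induced_distance_graph (R : realType) (d : nat)
    (T : finType) (e : rel T) (s : nat) : Prop :=
  exists2 A : {set T}, #|A| = s &
    exists (V : set 'rV[R]_d) (E : rel 'rV[R]_d),
      distance_graph V E /\ induced_isomorphic e A V E.

Definition distance_ramsey_property (R : realType) (s t d n : nat) : Prop :=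
  forall e : rel 'I_n, simple_graph e ->
    has_induced_distance_graph R d e s \/
    has_induced_distance_graph R d (compl_graph e) t.

Definition distance_ramsey_min (R : realType) (s t d : nat) : set nat :=
  [set n | distance_ramsey_property R s t d n /\
    forall m, distance_ramsey_property R s t d m -> (n <= m)%N].

(* The default value 0 is not used when [0 < d]; see [distance_ramseyP]. *)
Definition distance_ramsey (R : realType) (s t d : nat) : nat :=
  xget 0%N (distance_ramsey_min R s t d).

Lemma ramsey_independent_or_clique (T : finType) (e : rel T) (k s t : nat)
    (A : {set T}) :
  symmetric e -> (s + t = k)%N -> (2 ^ k <= #|A|)%N ->
  (exists2 B : {set T}, B \subset A & #|B| = s /\
     {in B &, forall x y, x != y -> ~~ e x y}) \/
  (exists2 B : {set T}, B \subset A & #|B| = t /\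
     {in B &, forall x y, x != y -> e x y}).
Proof.
move=> sym_e; elim: k s t A => [|k IH] s t A.
  case: s t => [|s] [|t] // _ _; left.
  exists finset.set0; first exact: finset.sub0set.
  by rewrite cards0; split=> // x y; rewrite inE.
case: s => [_ _|s].
  left; exists finset.set0; first exact: finset.sub0set.
  by rewrite cards0; split=> // x y; rewrite inE.
case: t => [_ _|t].
  right; exists finset.set0; first exact: finset.sub0set.
  by rewrite cards0; split=> // x y; rewrite inE.
move=> st cA; have /card_gt0P[x xA] : (0 < #|A|)%N.
  by apply: leq_trans cA; rewrite expn_gt0.
pose N := [set y in A :\ x | e x y]; pose M := [set y in A :\ x | ~~ e x y].
have NM : (#|N| + #|M|).+1 = #|A|.
  rewrite (cardsD1 x A) xA add1n -(cardsID [set y | e x y] (A :\ x)).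
  by congr (_ + _).+1; apply: eq_card => y; rewrite !inE andbC.
have NA : N \subset A.
  by apply/fintype.subsetP=> y; rewrite !inE => /andP[/andP[]].
have MA : M \subset A.
  by apply/fintype.subsetP=> y; rewrite !inE => /andP[/andP[]].
have [cM|cM] := leqP (2 ^ k) #|M|.
  have [|[B BM [cB iB]]|[B BM [cB iB]]] := IH s t.+1 M _ cM.
  - by move: st; rewrite addSn => -[].
  - have xB y : y \in B -> (y != x) && ~~ e x y.
      by move=> /(fintype.subsetP BM); rewrite !inE => /andP[/andP[-> _] ->].
    left; exists (x |: B).
      by rewrite finset.subUset finset.sub1set xA (fintype.subset_trans BM).
    split.
      by rewrite cardsU1 cB; case: (boolP (x \in B)) => // /xB; rewrite eqxx.
    move=> y z; rewrite !inE => /orP[/eqP->|yB] /orP[/eqP->|zB].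
    + by rewrite eqxx.
    + by case/andP: (xB _ zB).
    + by rewrite sym_e; case/andP: (xB _ yB).
    + exact: iB.
  - by right; exists B => //; apply: fintype.subset_trans BM MA.
have cN : (2 ^ k <= #|N|)%N.
  rewrite -(leq_add2r (2 ^ k)) addnn -mul2n -expnS.
  by apply: leq_trans cA _; rewrite -NM -addnS leq_add2l.
have [|[B BN [cB iB]]|[B BN [cB iB]]] := IH s.+1 t N _ cN.
- by move: st; rewrite addnS => -[].
- by left; exists B => //; apply: fintype.subset_trans BN NA.
- have xB y : y \in B -> (y != x) && e x y.
    by move=> /(fintype.subsetP BN); rewrite !inE => /andP[/andP[-> _] ->].
  right; exists (x |: B).
    by rewrite finset.subUset finset.sub1set xA (fintype.subset_trans BN).
  split.
    by rewrite cardsU1 cB; case: (boolP (x \in B)) => // /xB; rewrite eqxx.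
  move=> y z; rewrite !inE => /orP[/eqP->|yB] /orP[/eqP->|zB].
  + by rewrite eqxx.
  + by case/andP: (xB _ zB).
  + by rewrite sym_e; case/andP: (xB _ yB).
  + exact: iB.
Qed.

Lemma independent_distance_graph (R : realType) (d n s : nat)
    (e : rel 'I_n) (B : {set 'I_n}) :
  (0 < d)%N -> #|B| = s -> {in B &, forall x y, ~~ e x y} ->
  has_induced_distance_graph R d e s.
Proof.
move=> d0 cB iB; exists B => //.
pose f (i : 'I_n) : 'rV[R]_d := const_mx (val i)%:R.
exists (f @` [set` B]), (fun _ _ => false); split; first by [].
exists f; split; last by move=> x y xB yB; apply/negbTE/iB.
split=> // x y _ _ /matrixP/(_ 0 (Ordinal d0)); rewrite !mxE => /eqP.
by rewrite eqr_nat => /eqP/val_inj.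
Qed.

Lemma distance_ramseyP (R : realType) (s t d : nat) : (0 < d)%N ->
  distance_ramsey_min R s t d (distance_ramsey R s t d).
Proof.
move=> d0; apply: xgetPex.
have exn : exists n, `[< distance_ramsey_property R s t d n >].
  exists (2 ^ (s + t))%N; apply/asboolP => e [sym_e irr_e].
  have [|[B _ [cB iB]]|[B _ [cB iB]]] :=
    @ramsey_independent_or_clique _ e (s + t) s t [set: _] sym_e erefl.
  - by rewrite cardsT card_ord.
  - left; apply: independent_distance_graph cB _ => // x y xB yB.
    by have [->|/iB->//] := eqVneq x y; rewrite irr_e.
  - right; apply: independent_distance_graph cB _ => // x y xB yB.
    by rewrite /compl_graph /=; case: eqVneq => //= xy; rewrite iB.
exists (ex_minn exn); case: ex_minnP => n /asboolP Pn minn.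
by split=> // m Pm; apply: minn; apply/asboolP.
Qed.

(* Main.v *)
Require Import Defs.
From mathcomp Require Import ring lra zify.

(** The bound comes from the first moment method on the random graph with edge
    probability 1/2, for which the labelled distance graphs on [s] vertices have
    to be counted.  Write [k = d %/ 2].

    Density.  In R^d there are no [k + 1] classes of three points with all the
    distances between different classes equal to 1: each class would span a
    plane, and [k + 1] pairwise orthogonal planes need dimension [2 k + 2 > d]
    ([unit_multipartite_dim]).  By the Erdos-Stone theorem ([erdos_stone]) a unit
    distance graph on [s] vertices has at most [(1 - 1 / k + o(1)) s ^ 2 / 2]
    edges, so it misses at least [(1 / k - o(1)) s ^ 2 / 2] pairs
    ([card_unit_pattern_le]).

    Entropy.  A distance graph is a subgraph of the graph of all the unit
    distances among its vertices.  The latter is the zero pattern of [s ^ 2]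
    quadratic polynomials in the [s * d] coordinates, and the linear algebra
    bound on zero patterns ([card_zero_patterns]) shows that there are only
    [2 ^ (O(s * ln s))] of them, which is negligible beside [2 ^ (s ^ 2)]
    ([card_unit_patterns]).

    Probability.  If a graph on [n] vertices induces a distance graph on some
    [s] vertices, then it misses all the [q ~ s ^ 2 / (2 k)] pairs missed by one
    of these patterns, which has probability [2 ^ - q]; the same holds for the
    complement.  There are at most [n ^ s] ways to place [s] vertices, so a
    graph with neither property exists as long as
    [2 * n ^ s * 2 ^ (O(s * ln s)) < 2 ^ q], that is, for [n] up to
    [2 ^ ((1 / (2 k) - o(1)) s)] ([distance_ramsey_property_count]). *)

Set Implicit Arguments.
Unset Strict Implicit.
Unset Printing Implicit Defensive.
Import Order.TTheory GRing.Theory Num.Theory.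
Local Open Scope ring_scope.

(** * Orthogonality of the classes of a unit distance multipartite graph *)

Definition dotv (R : realType) (d : nat) (x y : 'rV[R]_d) : R :=
  \sum_(i < d) x 0 i * y 0 i.

Lemma dotvC (R : realType) (d : nat) (x y : 'rV[R]_d) : dotv x y = dotv y x.
Proof. by apply: eq_bigr => i _; rewrite mulrC. Qed.

Lemma dotvDl (R : realType) (d : nat) (x y z : 'rV[R]_d) :
  dotv (x + y) z = dotv x z + dotv y z.
Proof. by rewrite -big_split; apply: eq_bigr => i _; rewrite mxE mulrDl. Qed.

Lemma dotvZl (R : realType) (d : nat) (a : R) (x y : 'rV[R]_d) :
  dotv (a *: x) y = a * dotv x y.
Proof. by rewrite mulr_sumr; apply: eq_bigr => i _; rewrite mxE mulrA. Qed.

Lemma dotvBl (R : realType) (d : nat) (x y z : 'rV[R]_d) :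
  dotv (x - y) z = dotv x z - dotv y z.
Proof. by rewrite dotvDl -scaleN1r dotvZl mulN1r. Qed.

Lemma dotvBr (R : realType) (d : nat) (x y z : 'rV[R]_d) :
  dotv x (y - z) = dotv x y - dotv x z.
Proof. by rewrite dotvC dotvBl !(dotvC x). Qed.

Lemma dotvZr (R : realType) (d : nat) (a : R) (x y : 'rV[R]_d) :
  dotv x (a *: y) = a * dotv x y.
Proof. by rewrite dotvC dotvZl dotvC. Qed.

Lemma dotvv_eq0 (R : realType) (d : nat) (x : 'rV[R]_d) :
  (dotv x x == 0) = (x == 0).
Proof.
rewrite /dotv psumr_eq0 => [|i _]; last by rewrite -expr2 sqr_ge0.
apply/allP/eqP => [x0|-> i _]; last by rewrite /= mxE mul0r eqxx.
apply/rowP => i; rewrite mxE; apply/eqP.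
by have := x0 i (mem_index_enum i); rewrite /= mulf_eq0 orbb.
Qed.

Lemma edistC (R : realType) (d : nat) (x y : 'rV[R]_d) : edist x y = edist y x.
Proof.
by congr Num.sqrt; apply: eq_bigr => i _; rewrite -sqrrN opprB.
Qed.

Lemma edist1_dotv (R : realType) (d : nat) (x y : 'rV[R]_d) :
  (edist x y == 1) = (dotv (x - y) (x - y) == 1).
Proof.
have -> : dotv (x - y) (x - y) = \sum_(i < d) (x 0 i - y 0 i) ^+ 2.
  by apply: eq_bigr => i _; rewrite !mxE expr2.
rewrite /edist; set S := \sum_(i < d) _.
have S0 : 0 <= S by apply: sumr_ge0 => i _; apply: sqr_ge0.
by rewrite -{1}sqrtr1 eqr_sqrt.
Qed.

(** The Gram matrix of such a family is diagonal and invertible, hence of rank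
    [m], and it factors through ['rV_d]. *)
Lemma card_orthogonal (R : realType) (d m : nat) (f : 'I_m -> 'rV[R]_d) :
  (forall i, f i != 0) -> (forall i j, i != j -> dotv (f i) (f j) = 0) ->
  (m <= d)%N.
Proof.
move=> f0 fo; pose M := \matrix_(i < m) f i.
have MM : M *m M^T = diag_mx (\row_i dotv (f i) (f i)).
  apply/matrixP => i j; rewrite !mxE.
  have -> : \sum_l M i l * M^T l j = dotv (f i) (f j).
    by apply: eq_bigr => l _; rewrite !mxE.
  by have [->|/fo->] := eqVneq i j; rewrite ?mulr1n ?mulr0n.
have uM : M *m M^T \in unitmx.
  rewrite MM unitmxE det_diag unitfE; apply/prodf_neq0 => i _.
  by rewrite mxE dotvv_eq0.
rewrite -(mxrank_unit uM); exact: mulmx_max_rank.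
Qed.

(** The vector is a nonzero multiple of the component of [c - a] orthogonal to
    [b - a].  It could only vanish for [c] on the line [ab], and a line meets
    a sphere in at most two points. *)
Lemma sphere_noncollinear (R : realType) (d : nat) (o a b c : 'rV[R]_d) (r : R) :
  dotv (a - o) (a - o) = r -> dotv (b - o) (b - o) = r ->
  dotv (c - o) (c - o) = r -> a != b -> a != c -> b != c ->
  dotv (b - a) (b - a) *: (c - a) - dotv (c - a) (b - a) *: (b - a) != 0.
Proof.
move=> ha hb hc ab ac bc; set v := b - a; set w := c - a; set p := a - o in ha.
have v0 : dotv v v != 0 by rewrite dotvv_eq0 subr_eq0 eq_sym.
apply/negP; rewrite subr_eq0 => /eqP vw.
have {vw} wE : w = (dotv w v / dotv v v) *: v.
  by rewrite mulrC -scalerA -vw scalerA mulVf // scale1r.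
move: wE; move: (_ / _) => l wE.
have eqb : b - o = v + p by rewrite addrA subrK.
have eqc : c - o = w + p by rewrite addrA subrK.
have sq (x y : 'rV[R]_d) :
    dotv (x + y) (x + y) = dotv x x + 2 * dotv x y + dotv y y.
  by rewrite dotvDl !(dotvC _ (x + y)) !dotvDl (dotvC y x); ring.
move: hb hc; rewrite eqb eqc (sq v p) (sq w p) wE !dotvZl !dotvZr ha => hb hc.
have : l * (l - 1) * dotv v v = 0.
  have -> : l * (l - 1) * dotv v v =
     (l * (l * dotv v v) + 2 * (l * dotv v p) + r) - r
      - l * ((dotv v v + 2 * dotv v p + r) - r) by ring.
  by rewrite hb hc subrr mulr0 subrr.
move/eqP; rewrite !mulf_eq0 (negbTE v0) orbF => /orP[/eqP l0|].
  by move: wE; rewrite l0 scale0r => /eqP; rewrite subr_eq0 eq_sym (negbTE ac).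
rewrite subr_eq0 => /eqP l1; move: wE; rewrite l1 scale1r => /addIr/eqP.
by rewrite eq_sym (negbTE bc).
Qed.

(** Both [x] and [y] lie in the hyperplane of the points equidistant from [a]
    and [b], whose normal is [b - a]. *)
Lemma cross_orthogonal (R : realType) (d : nat) (a b x y : 'rV[R]_d) (r : R) :
  dotv (a - x) (a - x) = r -> dotv (a - y) (a - y) = r ->
  dotv (b - x) (b - x) = r -> dotv (b - y) (b - y) = r ->
  dotv (b - a) (y - x) = 0.
Proof.
rewrite !(dotvBl, dotvBr) (dotvC x a) (dotvC y a) (dotvC x b) (dotvC y b).
by move=> *; lra.
Qed.

(** Each class of three points is noncollinear, as it lies on a unit sphere
    about any point of another class, and so it spans two dimensions; the
    planes of different classes are orthogonal.  The bound is a count of the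
    [r.*2] orthogonal vectors that result. *)
Lemma unit_multipartite_dim (R : realType) (d r : nat)
    (a b c : nat -> 'rV[R]_d) :
  (1 < r)%N ->
  (forall i, (i < r)%N -> [/\ a i != b i, a i != c i & b i != c i]) ->
  (forall i j, (i < r)%N -> (j < r)%N -> i != j ->
     forall x y, x \in [:: a i; b i; c i] -> y \in [:: a j; b j; c j] ->
       edist x y = 1) ->
  (r.*2 <= d)%N.
Proof.
move=> r1 dis uni.
have {}uni i j : (i < r)%N -> (j < r)%N -> i != j ->
     forall x y, x \in [:: a i; b i; c i] -> y \in [:: a j; b j; c j] ->
       dotv (x - y) (x - y) = 1.
  move=> ir jr ij x y xi yj; apply/eqP; rewrite -edist1_dotv; apply/eqP.
  exact: (uni i j).
pose v i := b i - a i; pose w i := c i - a i.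
pose z i := dotv (v i) (v i) *: w i - dotv (w i) (v i) *: v i.
(* the vectors [2 i] and [2 i + 1] form an orthogonal basis of the plane of
   class [i] *)
pose f (i : 'I_(r.*2)) := if odd i then z i./2 else v i./2.
have half_lt (i : 'I_(r.*2)) : (i./2 < r)%N by rewrite ltn_half_double.
apply: (@card_orthogonal _ _ _ f) => [i|i j ij].
  have ir := half_lt i; have [ab ac bc] := dis _ ir.
  rewrite /f; case: ifP => _; last by rewrite subr_eq0 eq_sym.
  (* the centre of the sphere is taken in any other class *)
  have [j jr ij] : exists2 j, (j < r)%N & i./2 != j.
    by case: (i./2) => [|m]; [exists 1%N | exists 0%N => //; apply: ltn_trans r1].
  by apply: (@sphere_noncollinear _ _ (a j) _ _ _ 1) => //;
     apply: (uni _ _ ir jr ij); rewrite !inE eqxx ?orbT.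
have [e|ne] := eqVneq i./2 j./2.
  have vz l : dotv (v l) (z l) = 0.
    by rewrite dotvBr !dotvZr (dotvC (v l) (w l)); ring.
  have : odd i != odd j.
    apply: contra ij => /eqP o; apply/eqP/val_inj.
    by rewrite /= -(odd_double_half i) -(odd_double_half j) e o.
  rewrite /f e; case: (odd i); case: (odd j) => // _.
  by rewrite dotvC.
have ir := half_lt i; have jr := half_lt j.
have O x y : x \in [:: b i./2; c i./2] -> y \in [:: b j./2; c j./2] ->
    dotv (x - a i./2) (y - a j./2) = 0.
  rewrite !inE => /orP[]/eqP-> /orP[]/eqP->;
   apply: (@cross_orthogonal _ _ _ _ _ _ 1);
   by apply: (uni _ _ ir jr ne); rewrite !inE eqxx ?orbT.
have {}O : [/\ dotv (v i./2) (v j./2) = 0, dotv (v i./2) (w j./2) = 0,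
    dotv (w i./2) (v j./2) = 0 & dotv (w i./2) (w j./2) = 0].
  by split; apply: O; rewrite !inE eqxx ?orbT.
case: O => O1 O2 O3 O4.
have Oz y : dotv y (v j./2) = 0 -> dotv y (w j./2) = 0 -> dotv y (z j./2) = 0.
  by move=> yv yw; rewrite dotvBr !dotvZr yv yw !mulr0 subr0.
rewrite /f; case: (odd i); last by case: (odd j) => //; apply: Oz.
have Oz' y : dotv (v i./2) y = 0 -> dotv (w i./2) y = 0 -> dotv (z i./2) y = 0.
  by move=> vy wy; rewrite dotvBl !dotvZl vy wy !mulr0 subr0.
by apply: Oz'; case: (odd j) => //; apply: Oz.
Qed.

(** * The Erdos-Stone theorem *)

Definition degree_in (T : finType) (e : rel T) (A : {set T}) (x : T) : nat :=
  (\sum_(y in A) e x y)%N.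

(** The classes [f i] with [i >= r] are arbitrary.  For an irreflexive [e] the
    first [r] classes are automatically disjoint. *)
Definition complete_multipartite (T : finType) (e : rel T) (A : {set T})
    (r t : nat) (f : nat -> {set T}) : Prop :=
  (forall i, (i < r)%N -> f i \subset A /\ #|f i| = t) /\
  (forall i j, (i < r)%N -> (j < r)%N -> i != j ->
     {in f i & f j, forall x y, e x y}).

Lemma degree_in_card (T : finType) (e : rel T) (A : {set T}) (x : T) :
  degree_in e A x = #|[set y in A | e x y]|.
Proof.
rewrite -sum1dep_card big_mkcondr /=; apply: eq_bigr => y _.
by case: (e x y).
Qed.

Lemma degree_in_le (T : finType) (e : rel T) (A : {set T}) (x : T) :
  (degree_in e A x <= #|A|)%N.
Proof. by rewrite -sum1_card; apply: leq_sum => y _; apply: leq_b1. Qed.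

Lemma subset_of_card (T : finType) (A : {set T}) (k : nat) : (k <= #|A|)%N ->
  exists2 B : {set T}, B \subset A & #|B| = k.
Proof.
case/card_geqP => s [us sk sA]; exists [set x in s].
  by apply/fintype.subsetP => x; rewrite inE; apply: sA.
by rewrite cardsE (card_uniqP us).
Qed.

Lemma pigeonhole_fiber (T U : finType) (g : T -> U) (W : {set T}) (P : {set U})
    (t : nat) :
  (0 < t)%N -> {in W, forall x, g x \in P} -> (t * #|P| <= #|W|)%N -> (0 < #|W|)%N ->
  exists y, (t <= #|[set x in W | g x == y]|)%N.
Proof.
move=> t0 gP tW W0; apply/existsP; apply: contraTT tW => /existsPn h.
have P0 : (0 < #|P|)%N.
  by case/card_gt0P: W0 => x /gP gx; apply/card_gt0P; exists (g x).
rewrite -ltnNge -sum1_card (partition_big g (mem P)) //=.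
apply: (@leq_ltn_trans (\sum_(y in P) t.-1)%N).
  apply: leq_sum => y _; rewrite -ltnS prednK // ltnNge.
  by rewrite sum1dep_card; apply: h.
by rewrite sum_nat_const mulnC ltn_pmul2r // prednK.
Qed.

Lemma leq_card_bigcup (T I : finType) (P : pred I) (F : I -> {set T}) :
  (#|\bigcup_(i | P i) F i| <= \sum_(i | P i) #|F i|)%N.
Proof.
apply: (big_ind2 (fun (S : {set T}) n => #|S| <= n)%N); rewrite ?cards0 //.
by move=> S x S' x' Sx Sx'; apply: leq_trans (leq_card_setU S S') (leq_add Sx Sx').
Qed.

(** The inductive step of the Erdos-Stone theorem.  Let [W] be the vertices with
    at least [t] neighbours in each of the [r.+1] large classes.  A vertex
    outside [W] sends at most [r * m + t] edges to the classes, while the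
    degree condition gives [r * m + eps * r.+1 * m] on average; hence [W] is a
    positive proportion of [A].  As soon as it outnumbers the [2 ^ (r.+1 * m)]
    possible neighbourhoods in the union of the classes, [t] vertices of [W]
    have the same one.  They form the new class, and [t] vertices of their
    common neighbourhood in each old class form the others. *)
Lemma erdos_stone_extend (R : realType) (r t m : nat) (eps : R) (T : finType)
    (e : rel T) (A : {set T}) (f : nat -> {set T}) :
  (0 < t)%N -> (t <= m)%N -> 0 < eps -> symmetric e ->
  2 * t%:R <= eps * r.+1%:R * m%:R ->
  2 * t%:R * 2 ^+ (r.+1 * m) <= eps * r.+1%:R * #|A|%:R ->
  {in A, forall x, (1 - r.+1%:R^-1 + eps) * #|A|%:R <= (degree_in e A x)%:R} ->
  complete_multipartite e A r.+1 m f ->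
  exists g, complete_multipartite e A r.+2 t g.
Proof.
move=> t0 tm eps0 sym_e mlarge Alarge degA [fA fe].
pose W := [set x in A | [forall i : 'I_r.+1, (t <= degree_in e (f i) x)%N]].
have WA : W \subset A by apply/fintype.subsetP => x; rewrite inE => /andP[].
have upper : (\sum_(x in A) \sum_(i < r.+1) degree_in e (f i) x <=
    #|W| * (r.+1 * m) + (#|A| - #|W|) * (r * m + t))%N.
  rewrite (big_setID W) /= (finset.setIidPr WA).
  have -> : (#|A| - #|W|)%N = #|A :\: W| by rewrite cardsD (finset.setIidPr WA).
  rewrite -!sum_nat_const; apply: leq_add; apply: leq_sum => x.
    move=> _; rewrite -[in leqRHS](card_ord r.+1) -sum_nat_const.
    by apply: leq_sum => i _; have [_ <-] := fA i (ltn_ord i); apply: degree_in_le.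
  rewrite !inE => /andP[/[swap] ->] /= /forallPn[i]; rewrite -ltnNge => lti.
  rewrite (bigD1 i) //= addnC; apply: leq_add; last exact: ltnW.
  apply: (@leq_trans (\sum_(j < r.+1 | j != i) m)).
    by apply: leq_sum => j _; have [_ <-] := fA j (ltn_ord j); apply: degree_in_le.
  by rewrite sum_nat_const cardC1 card_ord.
(* the edges between [A] and the classes, counted from both ends *)
have swap : (\sum_(x in A) \sum_(i < r.+1) degree_in e (f i) x =
    \sum_(i < r.+1) \sum_(b in f i) degree_in e A b)%N.
  rewrite exchange_big; apply: eq_bigr => i _; rewrite exchange_big.
  by apply: eq_bigr => y _; apply: eq_bigr => x _; rewrite sym_e.
have lower : (r.+1 * m)%:R * ((1 - r.+1%:R^-1 + eps) * #|A|%:R) <=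
    (\sum_(x in A) \sum_(i < r.+1) degree_in e (f i) x)%:R :> R.
  have sum_cst I (S : {set I}) (z : R) : \sum_(b in S) z = #|S|%:R * z.
    by rewrite sumr_const mulr_natl.
  rewrite swap natr_sum natrM -mulrA -[X in X%:R * _](card_ord r.+1) -cardsT.
  rewrite -sum_cst big_mkcond; apply: ler_sum => i _; rewrite finset.in_setT.
  have [fiA fim] := fA i (ltn_ord i).
  rewrite natr_sum -[X in X%:R * _]fim -sum_cst; apply: ler_sum => b bi.
  by apply: degA; apply: (fintype.subsetP fiA).
have cWA := subset_leq_card WA.
(* with [k = r.+1], [M = m], [n = #|A|] and [w = #|W|], the two counts give
   [eps k M n - n t <= w (M - t)], and [n t] is at most half of [eps k M n] *)
have Wlarge : (t * 2 ^ (r.+1 * m) <= #|W|)%N.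
  move: upper lower; rewrite -(ler_nat R) => up lo; have {up lo} := le_trans lo up.
  rewrite -(ler_nat R) (natrM _ t) natrX.
  rewrite !(natrD, natrM, natrB _ cWA).
  have m0 : 0 < m%:R :> R by rewrite ltr0n (leq_trans t0).
  have t0R : 0 <= t%:R :> R by [].
  have n0 : 0 <= #|A|%:R :> R by [].
  have w0 : 0 <= #|W|%:R :> R by [].
  have kV : r.+1%:R * r.+1%:R^-1 = 1 :> R by rewrite divff.
  have -> : r%:R = r.+1%:R - 1 :> R by rewrite -[r.+1]addn1 natrD addrK.
  move: (r.+1%:R : R) (r.+1%:R^-1 : R) kV mlarge Alarge => k k' kV mlarge Alarge.
  move: (m%:R : R) (t%:R : R) (#|A|%:R : R) (#|W|%:R : R) (2 ^+ _ : R)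
    m0 t0R n0 w0 mlarge Alarge => M t' n w Q m0 t0R n0 w0 mlarge Alarge lo.
  have {lo} h1 : M * (eps * k * n) <= w * M - w * t' + n * t'.
    have -> : M * (eps * k * n) = k * M * ((1 - k' + eps) * n) - (k - 1) * M * n
        + (k * k' - 1) * M * n by ring.
    by rewrite kV subrr !mul0r addr0; lra.
  have h2 : n * (2 * t') <= n * (eps * k * M) by apply: ler_wpM2l.
  have h3 : 0 <= w * t' by apply: mulr_ge0.
  have h4 : M * (eps * k * n / 2) <= M * w by lra.
  by move: h4; rewrite ler_pM2l // => h4; lra.
have W0 : (0 < #|W|)%N by apply: leq_trans Wlarge; rewrite muln_gt0 t0 expn_gt0.
pose B := (\bigcup_(i < r.+1) f i)%SET.
have cB : (#|B| <= r.+1 * m)%N.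
  apply: leq_trans (leq_card_bigcup _ _) _.
  rewrite -[in leqRHS](card_ord r.+1) -sum_nat_const.
  by apply: leq_sum => i _; have [_ ->] := fA i (ltn_ord i).
have fB i : (i < r.+1)%N -> f i \subset B.
  by move=> ir; apply: (finset.bigcup_sup (Ordinal ir)).
pose trace x := [set y in B | e x y].
have [D tD] : exists D, (t <= #|[set x in W | trace x == D]|)%N.
  apply: (@pigeonhole_fiber _ _ trace W (powerset B)) => //.
    by move=> x _; rewrite inE; apply/fintype.subsetP => y; rewrite inE => /andP[].
  apply: leq_trans Wlarge; rewrite leq_mul2l card_powerset leq_exp2l // cB orbT //.
have [W' sW' cW'] := subset_of_card tD.
have W'P x : x \in W' -> [/\ x \in A,
    forall i, (i < r.+1)%N -> (t <= degree_in e (f i) x)%N & trace x = D].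
  move=> /(fintype.subsetP sW'); rewrite !inE => /andP[/andP[xA /forallP h] /eqP tr].
  by split=> // i ir; apply: (h (Ordinal ir)).
have /choice[g gP] : forall i, exists S : {set T}, (i < r.+1)%N ->
    S \subset f i :&: D /\ #|S| = t.
  move=> i; have [ir|_] := ltnP i r.+1; last by exists finset.set0.
  have [x xW'] : exists x, x \in W' by apply/card_gt0P; rewrite cW'.
  have [_ /(_ i ir) + trx] := W'P x xW'; rewrite degree_in_card.
  move=> /subset_of_card[S sS cS]; exists S => _; split=> //.
  apply: fintype.subset_trans sS _; rewrite -trx; apply/fintype.subsetP => y.
  by rewrite !inE => /andP[yf ->]; rewrite yf (fintype.subsetP (fB i ir)).
(* the new class gets the index [r.+1] *)
exists (fun i => if i == r.+1 then W' else g i); split=> [i|i j].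
  rewrite ltnS leq_eqVlt; case: eqP => [_ _|_ /= ir].
    by split=> //; apply/fintype.subsetP => x /W'P[].
  have [gs gt] := gP i ir; have [fiA _] := fA i ir; split=> //.
  apply: fintype.subset_trans fiA; apply: fintype.subset_trans gs _.
  exact: finset.subsetIl.
have W'g k : (k < r.+1)%N -> {in W' & g k, forall x y, e x y}.
  move=> kr x y /W'P[_ _ trx] yg; have [gs _] := gP k kr.
  move/(fintype.subsetP gs): yg; rewrite -trx !inE.
  by case/and3P.
have lt_max k : (k < r.+2)%N -> k != r.+1 -> (k < r.+1)%N.
  by rewrite ltnS leq_eqVlt => /orP[->|].
move=> ir jr; case: (eqVneq i r.+1) => [->|/(lt_max _ ir) {}ir];
  case: (eqVneq j r.+1) => [_|/(lt_max _ jr) {}jr] //=.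
- by move=> _; apply: W'g.
- by move=> _ x y xg yW; rewrite sym_e; apply: (W'g i).
move=> ij x y xg yg; have [gi _] := gP i ir; have [gj _] := gP j jr.
apply: (fe i j) => //.
  by move/(fintype.subsetP gi): xg; rewrite inE => /andP[].
by move/(fintype.subsetP gj): yg; rewrite inE => /andP[].
Qed.

Lemma eventually_nat_ge (R : realType) (c x : R) : 0 < c ->
  exists n0, forall n, (n0 <= n)%N -> x <= c * n%:R.
Proof.
move=> c0; exists (Num.truncn (x / c)).+1 => n n0n.
rewrite mulrC -ler_pdivrMr // ltW // (lt_le_trans (truncnS_gt _)) //.
by rewrite ler_nat.
Qed.

(** Induction on [r]: the degree condition for [r.+2] classes implies the one for
    [r.+1] classes, which provides classes of any size [m]; a single class
    costs nothing.  The size [m] has to be large in terms of [t] and [eps]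
    only, so that [A] can be taken large afterwards. *)
Lemma erdos_stone_min_degree (R : realType) (r t : nat) (eps : R) :
  (0 < t)%N -> 0 < eps ->
  exists n0, forall (T : finType) (e : rel T) (A : {set T}),
    symmetric e -> (n0 <= #|A|)%N ->
    {in A, forall x, (1 - r.+1%:R^-1 + eps) * #|A|%:R <= (degree_in e A x)%:R} ->
    exists f, complete_multipartite e A r.+2 t f.
Proof.
elim: r t eps => [|r IH] t eps t0 eps0.
all: have [m1 m1P] := eventually_nat_ge (2 * t%:R) eps0.
all: pose m := maxn t m1; have tm : (t <= m)%N by rewrite leq_maxl.
all: have {m1P}epsm : 2 * t%:R <= eps * m%:R by apply: m1P; rewrite leq_maxr.
- have [n1 n1P] := eventually_nat_ge (2 * t%:R * 2 ^+ (1 * m)) eps0.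
  exists (maxn m n1) => T e A sym_e; rewrite geq_max => /andP[mA n1A] degA.
  have [S SA cS] := subset_of_card mA.
  apply: (@erdos_stone_extend R 0 t m eps T e A (fun=> S)) => //.
  + by rewrite mulr1.
  + by rewrite mulr1; apply: n1P.
  + by split=> [i _|[|i] [|j]].
- have m0 : (0 < m)%N by apply: leq_trans tm.
  have k1 : 1 <= r.+2%:R :> R by rewrite ler1n.
  have [n1 IH1] := IH m eps m0 eps0.
  have [n2 n2P] := eventually_nat_ge (2 * t%:R * 2 ^+ (r.+2 * m)) eps0.
  exists (maxn n1 n2) => T e A sym_e; rewrite geq_max => /andP[n1A n2A] degA.
  have [f fP] : exists f, complete_multipartite e A r.+2 m f.
    apply: IH1 => // x /degA; apply: le_trans; apply: ler_wpM2r => //.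
    by rewrite lerD2r lerD2l lerN2 lef_pV2 ?posrE ?ltr0n // ler_nat.
  apply: (@erdos_stone_extend R r.+1 t m eps T e A f) => //.
  + apply: le_trans epsm _; rewrite -mulrA ler_pM2l //.
    by rewrite ler_peMl.
  + apply: le_trans (n2P _ n2A) _; rewrite -mulrA ler_pM2l //.
    by rewrite ler_peMl.
Qed.

(** Vertices of low degree are removed one at a time.  Removing [x] from [A]
    costs [2 * degree_in e A x <= 2 * c * #|A|], the increment of
    [c * (n ^ 2 + n)] between [#|A| - 1] and [#|A|]; the last [n0] vertices
    carry at most [n0 ^ 2]. *)
Lemma degree_sum_le (R : realType) (T : finType) (e : rel T) (c : R) (n0 : nat)
    (A : {set T}) :
  symmetric e -> 0 <= c ->
  (forall B : {set T}, B \subset A -> (n0 <= #|B|)%N ->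
     exists2 x, x \in B & (degree_in e B x)%:R <= c * #|B|%:R) ->
  (\sum_(x in A) degree_in e A x)%:R <=
     n0%:R ^+ 2 + c * (#|A|%:R ^+ 2 + #|A|%:R).
Proof.
move=> sym_e c0; have [n] := ubnP #|A|; elim: n A => // n IH A.
rewrite ltnS => cA low.
have [small|large] := ltnP #|A| n0.
  apply: (@le_trans _ _ (n0%:R ^+ 2)); last first.
    by rewrite lerDl mulr_ge0 // addr_ge0.
  rewrite -natrX ler_nat.
  apply: (@leq_trans (\sum_(x in A) #|A|)).
    by apply: leq_sum => x _; apply: degree_in_le.
  by rewrite sum_nat_const expnS expn1 leq_mul // ltnW.
have [x xA degx] := low A (fintype.subxx _) large.
have cAx : #|A| = #|A :\ x|.+1 by rewrite (cardsD1 x A) xA.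
have {}IH : (\sum_(y in A :\ x) degree_in e (A :\ x) y)%:R <=
     n0%:R ^+ 2 + c * (#|A :\ x|%:R ^+ 2 + #|A :\ x|%:R).
  apply: IH; first by rewrite -cAx.
  move=> B BA; apply: low; apply: fintype.subset_trans BA _.
  exact: finset.subsetDl.
have split : (\sum_(y in A) degree_in e A y <=
    2 * degree_in e A x + \sum_(y in A :\ x) degree_in e (A :\ x) y)%N.
  rewrite (big_setD1 x) //= mul2n -addnn -addnA leq_add2l.
  have -> : (\sum_(y in A :\ x) degree_in e A y =
     \sum_(y in A :\ x) (e y x : nat) + \sum_(y in A :\ x) degree_in e (A :\ x) y)%N.
    rewrite -big_split /=; apply: eq_bigr => y _.
    by rewrite {1}/degree_in (big_setD1 x).
  rewrite leq_add2r [in leqRHS]/degree_in (big_setD1 x xA) /=.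
  by apply: leq_trans (leq_addl _ _); apply: leq_sum => y _; rewrite sym_e.
move: split; rewrite -(ler_nat R) natrD natrM => /le_trans; apply.
move: degx; rewrite cAx -[#|A :\ x|.+1]addn1 natrD => degx.
by nra.
Qed.

(** The degree sum is twice the number of edges.  If it exceeded the bound,
    [degree_sum_le] would yield a large set in which every degree is high. *)
Lemma erdos_stone (R : realType) (r t : nat) (eps : R) :
  (0 < t)%N -> 0 < eps ->
  exists n0, forall (T : finType) (e : rel T),
    symmetric e -> (n0 <= #|T|)%N ->
    (forall f, ~ complete_multipartite e [set: T] r.+2 t f) ->
    (\sum_x degree_in e [set: T] x)%:R <= (1 - r.+1%:R^-1 + eps) * #|T|%:R ^+ 2.
Proof.
move=> t0 eps0; have eps2 : 0 < eps / 2 by rewrite divr_gt0.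
have [n1 ES] := erdos_stone_min_degree r t0 eps2.
pose c : R := 1 - r.+1%:R^-1 + eps / 2.
have c0 : 0 <= c.
  by rewrite addr_ge0 ?(ltW eps2) // subr_ge0 invf_le1 ?ltr0n // ler1n.
have [n2 n2P] := eventually_nat_ge (n1%:R ^+ 2 + c) eps2.
exists (maxn 1 n2) => T e sym_e; rewrite geq_max => /andP[n_gt0 /n2P n_large] free.
have := @degree_sum_le R T e c n1 [set: T] sym_e c0.
rewrite finset.cardsT => H.
have {}H : (\sum_x degree_in e [set: T] x)%:R <=
    n1%:R ^+ 2 + c * (#|T|%:R ^+ 2 + #|T|%:R).
  have -> : (\sum_x degree_in e [set: T] x =
      \sum_(x in [set: T]) degree_in e [set: T] x)%N.
    by apply: eq_bigl => x; rewrite finset.in_setT.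
  apply: H => B _ n1B; apply: contrapT => none.
  have [|f [fA fe]] := ES T e B sym_e n1B.
    move=> x xB; rewrite leNgt; apply/negP => lt; apply: none.
    by exists x => //; apply: ltW.
  apply: (free f); split=> // i ir; have [_ ->] := fA i ir.
  by split=> //; apply: finset.subsetT.
apply: le_trans H _.
have n_ge1 : 1 <= #|T|%:R :> R by rewrite ler1n.
have -> : 1 - r.+1%:R^-1 + eps = c + eps / 2 by rewrite /c -[in RHS]addrA -splitr.
have sq0 : 0 <= n1%:R ^+ 2 :> R by apply: sqr_ge0.
clearbody c.
move: (#|T|%:R : R) (n1%:R ^+ 2 : R) n_large n_ge1 sq0 => n q n_large n_ge1 sq0.
have : (q + c) * n <= eps / 2 * n * n by apply: ler_wpM2r => //; lra.
have : q <= q * n by rewrite ler_peMr.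
by rewrite expr2; move=> ? ?; lra.
Qed.

(** * Counting zero patterns of polynomials *)

Definition monom (R : realType) (V : finType) (m : V -> nat) (u : V -> R) : R :=
  \prod_v u v ^+ m v.

(** Polynomial functions with degree at most [M] in each variable separately.
    The degree is bounded variable by variable so that the number of monomials
    is simply [M.+1 ^ #|V|]. *)
Inductive polyfun (R : realType) (V : finType) (M : nat) :
    ((V -> R) -> R) -> Prop :=
| Polyfun0 : polyfun M (fun=> 0)
| PolyfunMonom (c : R) (m : V -> nat) : (forall v, m v <= M)%N ->
    polyfun M (fun u => c * monom m u)
| PolyfunD F G : polyfun M F -> polyfun M G -> polyfun M (F \+ G).

Lemma polyfunM (R : realType) (V : finType) (M N : nat) (F G : (V -> R) -> R) :
  polyfun M F -> polyfun N G -> polyfun (M + N) (F \* G).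
Proof.
move=> hF hG; elim: hF => [|c m hm|F1 F2 _ h1 _ h2].
- by rewrite (_ : _ \* _ = fun=> 0);
    [exact: Polyfun0 | apply/funext => u /=; rewrite mul0r].
- elim: hG => [|c' m' hm'|G1 G2 _ h1 _ h2].
  + by rewrite (_ : _ \* _ = fun=> 0);
      [exact: Polyfun0 | apply/funext => u /=; rewrite mulr0].
  + rewrite (_ : _ \* _ = fun u => (c * c') * monom (fun v => m v + m' v)%N u).
      by apply: PolyfunMonom => v; apply: leq_add.
    apply/funext => u /=; rewrite mulrACA; congr (_ * _).
    by rewrite -big_split; apply: eq_bigr => v _; rewrite exprD.
  + rewrite (_ : _ \* _ = (fun u => c * monom m u * G1 u) \+
                          (fun u => c * monom m u * G2 u)).
      exact: PolyfunD.
    by apply/funext => u /=; rewrite mulrDr.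
- rewrite (_ : _ \* _ = (F1 \* G) \+ (F2 \* G)); first exact: PolyfunD.
  by apply/funext => u /=; rewrite mulrDl.
Qed.

Lemma polyfun_le (R : realType) (V : finType) (M N : nat) (F : (V -> R) -> R) :
  (M <= N)%N -> polyfun M F -> polyfun N F.
Proof.
move=> MN; elim=> [|c m hm|F1 F2 _ h1 _ h2]; [exact: Polyfun0| |exact: PolyfunD].
by apply: PolyfunMonom => v; apply: leq_trans MN.
Qed.

Lemma polyfun_cst (R : realType) (V : finType) (M : nat) (c : R) :
  polyfun M (fun _ : V -> R => c).
Proof.
rewrite (_ : (fun=> c) = fun u => c * monom (fun=> 0)%N u); first exact: PolyfunMonom.
by apply/funext => u; rewrite /monom big1 ?mulr1.
Qed.

Lemma polyfun_var (R : realType) (V : finType) (c : R) (v : V) :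
  polyfun 1 (fun u => c * u v).
Proof.
rewrite (_ : (fun u => _) = fun u => c * monom (fun w => (w == v) : nat) u).
  by apply: PolyfunMonom => w; case: eqP.
apply/funext => u; congr (_ * _).
rewrite /monom (bigD1 v) //= eqxx expr1 big1 ?mulr1 // => w /negbTE->.
by rewrite expr0.
Qed.

Lemma polyfun_sum (R : realType) (V : finType) (M : nat) (I : Type) (s : seq I)
    (F : I -> (V -> R) -> R) :
  (forall i, polyfun M (F i)) -> polyfun M (fun u => \sum_(i <- s) F i u).
Proof.
move=> hF; elim: s => [|i s IH].
  rewrite (_ : (fun u => _) = fun=> 0); first exact: Polyfun0.
  by apply/funext => u; rewrite big_nil.
rewrite (_ : (fun u => _) = F i \+ fun u => \sum_(i <- s) F i u); first exact: PolyfunD.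
by apply/funext => u; rewrite big_cons.
Qed.

Lemma polyfun_prod (R : realType) (V : finType) (M : nat) (I : Type) (s : seq I)
    (F : I -> (V -> R) -> R) :
  (forall i, polyfun M (F i)) ->
  polyfun (size s * M) (fun u => \prod_(i <- s) F i u).
Proof.
move=> hF; elim: s => [|i s IH].
  rewrite (_ : (fun u => _) = fun=> 1); first exact: polyfun_cst.
  by apply/funext => u; rewrite big_nil.
rewrite (_ : (fun u => _) = F i \* fun u => \prod_(i <- s) F i u).
  exact: polyfunM.
by apply/funext => u; rewrite big_cons.
Qed.

(** On any [p] points the polynomial functions form a space of dimension at most
    the number of monomials. *)
Lemma polyfun_rowsub (R : realType) (V : finType) (M p : nat) (u : 'I_p -> V -> R)
    (F : (V -> R) -> R) : polyfun M F ->
  ((\row_j F (u j)) <=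
   (\matrix_(i < #|{: {ffun V -> 'I_M.+1}}|, j < p) 
      monom (fun v => (enum_val i : {ffun V -> 'I_M.+1}) v) (u j)))%MS.
Proof.
elim=> [|c m hm|F1 F2 _ h1 _ h2].
- rewrite (_ : \row_j _ = 0) ?sub0mx //; by apply/rowP => j; rewrite !mxE.
- pose m' : {ffun V -> 'I_M.+1} := [ffun v => inord (m v)].
  set B := (X in (_ <= X)%MS).
  rewrite (_ : \row_j _ = c *: row (enum_rank m') B).
    by apply: scalemx_sub; apply: row_sub.
  apply/rowP => j; rewrite !mxE enum_rankK; congr (_ * _).
  by apply: eq_bigr => v _; rewrite ffunE inordK ?ltnS.
- rewrite (_ : \row_j _ = \row_j F1 (u j) + \row_j F2 (u j)).
    exact: addmx_sub.
  by apply/rowP => j; rewrite !mxE.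
Qed.

(** Such a matrix is triangular for any linear order that refines inclusion. *)
Lemma subset_triangular_row_free (R : fieldType) (I : finType) (p : nat)
   (P : 'I_p -> {set I}) (A : 'M[R]_p) : injective P ->
   (forall i j, (A i j != 0) = (P j \subset P i)) -> row_free A.
Proof.
move=> Pinj HA; apply/row_freeP.
suff /row_freeP : row_free A by [].
rewrite -kermx_eq0; apply/eqP/row_matrixP => i0; rewrite row0.
set l := row i0 _.
have lA : l *m A = 0 by apply/sub_kermxP; apply: row_sub.
apply/rowP => j; rewrite [RHS]mxE; have [->//|lj] := eqVneq (l 0 j) 0.
(* for [P m] of maximal size among the indices of nonzero coefficients, the
   column [m] of [l *m A] has the single nonzero term [l 0 m * A m m] *)
have [m lm mmax] := @arg_maxnP _ j (fun i => l 0 i != 0) (fun i => #|P i|) lj.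
have := congr1 (fun B : 'rV_p => B 0 m) lA; rewrite !mxE (bigD1 m) //= big1.
  by move/eqP; rewrite addr0 mulf_eq0 (negbTE lm) -[_ == _]negbK HA fintype.subxx.
move=> i im; have [->|li] := eqVneq (l 0 i) 0; first by rewrite mul0r.
have [->|] := eqVneq (A i m) 0; first by rewrite mulr0.
rewrite HA => sub; case/eqP: im; apply: Pinj; apply/eqP.
by rewrite eq_sym eqEcard sub; apply: mmax.
Qed.

(** The linear algebra bound of Ronyai, Babai and Ganapathy.  Let [u P] be a
    point with zero pattern [P], and [g P] the product of the [f i] over
    [i \notin P]; then [g P] does not vanish at [u Q] exactly when [Q] is a
    subset of [P].  So the functions [g P] are linearly independent, and there
    are no more of them than monomials. *)
Lemma card_zero_patterns (R : realType) (V I : finType) (D : nat)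
    (f : I -> (V -> R) -> R) (Z : {set {set I}}) :
  (forall i, polyfun D (f i)) ->
  (forall P, P \in Z -> exists u, forall i, (i \in P) = (f i u == 0)) ->
  (#|Z| <= (#|I| * D).+1 ^ #|V|)%N.
Proof.
move=> fD hZ.
pose P (i : 'I_#|Z|) : {set I} := enum_val i.
have /choice[u hu] : forall i, exists u, forall j, (j \in P i) = (f j u == 0).
  by move=> i; apply: hZ; apply: enum_valP.
pose g (i : 'I_#|Z|) (x : V -> R) := \prod_(j <- enum (~: P i)) f j x.
pose A := \matrix_(i, j) g i (u j).
have gD i : polyfun (#|I| * D) (g i).
  apply: polyfun_le (polyfun_prod (enum (~: P i)) fD).
  by rewrite -cardE leq_mul2r max_card orbT.
have : row_free A.
  apply: (@subset_triangular_row_free _ _ _ P); first exact: enum_val_inj.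
  move=> i j; rewrite mxE /g big_enum_cond /=; apply/prodf_neq0/fintype.subsetP.
    move=> h x; rewrite hu; apply: contraTT => xi; apply: h.
    by rewrite inE xi.
  by move=> h x; rewrite andbT inE; apply: contra; rewrite -hu; apply: h.
rewrite /row_free => /eqP rA; apply: (@leq_trans (\rank A)); first by rewrite rA.
rewrite -[in X in (_ <= X)%N](card_ord (#|I| * D).+1) -card_ffun.
have sub : (A <= \matrix_(i < #|{: {ffun V -> 'I_(#|I| * D).+1}}|, j < #|Z|)
      monom (fun v => (enum_val i : {ffun V -> 'I_(#|I| * D).+1}) v) (u j))%MS.
  apply/row_subP => i; rewrite (_ : row i A = \row_j g i (u j)).
    exact: polyfun_rowsub.
  by apply/rowP => j; rewrite !mxE.
exact: leq_trans (mxrankS sub) (rank_leq_row _).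
Qed.

(** The graphs of all the unit distances among [s] labelled points; a labelled
    distance graph is the same as a subgraph of one of these. *)
Definition unit_patterns (R : realType) (d s : nat) : {set {set 'I_s * 'I_s}} :=
  [set P : {set 'I_s * 'I_s} | `[< exists x : 'I_s -> 'rV[R]_d, injective x /\
     forall i j, ((i, j) \in P) = (edist (x i) (x j) == 1) >]]%SET.

Lemma card_unit_patterns (R : realType) (d s : nat) :
  (#|unit_patterns R d s| <= (s * s * 2).+1 ^ (s * d))%N.
Proof.
pose f (e : 'I_s * 'I_s) (u : 'I_s * 'I_d -> R) : R :=
  \sum_(l < d) (u (e.1, l) - u (e.2, l)) ^+ 2 - 1.
have -> : (s * s)%N = #|{: 'I_s * 'I_s}| by rewrite card_prod !card_ord.
have -> : (s * d)%N = #|{: 'I_s * 'I_d}| by rewrite card_prod !card_ord.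
apply: (@card_zero_patterns _ _ _ 2 f) => [e|P].
  rewrite (_ : f e = (fun u => \sum_(l < d)
      (((fun u => 1 * u (e.1, l)) \+ (fun u => -1 * u (e.2, l))) \*
       ((fun u => 1 * u (e.1, l)) \+ (fun u => -1 * u (e.2, l)))) u) \+ (fun=> -1)).
    apply: PolyfunD; last exact: polyfun_cst.
    apply: polyfun_sum => l.
    by apply: (@polyfunM _ _ 1 1); apply: PolyfunD; apply: polyfun_var.
  by apply/funext => u; congr (_ - _); apply: eq_bigr => l _ /=; rewrite !mul1r mulN1r.
rewrite inE => /asboolP[x [_ hx]]; exists (fun q => x q.1 0 q.2) => -[i j].
rewrite hx edist1_dotv -subr_eq0; congr (_ - _ == _).
by apply: eq_bigr => l _; rewrite !mxE expr2.
Qed.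

(** * The random graph *)

(** A unit distance graph in dimension [d < 2 * r.+3] has no complete
    multipartite subgraph with [r.+3] classes of three points, so the
    Erdos-Stone theorem bounds its density by that of [r.+2] classes. *)
Lemma card_unit_pattern_le (R : realType) (d r : nat) (eps : R) :
  (d < r.+3.*2)%N -> 0 < eps ->
  exists s0, forall s, (s0 <= s)%N -> forall P, P \in unit_patterns R d s ->
    #|P|%:R <= (1 - r.+2%:R^-1 + eps) * s%:R ^+ 2.
Proof.
move=> dr eps0; have [s0 ES] := @erdos_stone R r.+1 3 eps isT eps0.
exists s0 => s s0s P; rewrite inE => /asboolP[x [xinj xP]].
pose e : rel 'I_s := [rel i j | (i, j) \in P].
have -> : #|P| = (\sum_i degree_in e [set: 'I_s] i)%N.
  rewrite -sum1_card pair_big_dep /= big_mkcond /=; apply: eq_big => [[i j]|[i j] _].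
    by rewrite finset.in_setT.
  by rewrite /e /=; case: (_ \in P).
have := ES _ e; rewrite card_ord; apply=> //.
  by move=> i j; rewrite /e /= !xP edistC.
move=> f [fA fe].
have /choice[g gP] : forall i, exists p : 'rV[R]_d * 'rV[R]_d * 'rV[R]_d,
    (i < r.+3)%N -> [/\ p.1.1 != p.1.2, p.1.1 != p.2, p.1.2 != p.2 &
      {subset [:: p.1.1; p.1.2; p.2] <= [seq x y | y in f i]}].
  move=> i; have [ir|_] := ltnP i r.+3; last by exists (0, 0, 0).
  have [_ /eqP] := fA i ir; rewrite eqn_leq => /andP[_ /card_geqP[l [ul]]].
  case: l ul => [|a [|b [|c [|]]]] //= ul _ sub; exists (x a, x b, x c) => _ /=.
  move: ul; rewrite !inE negb_or !(inj_eq xinj) !andbT => /andP[/andP[ab ac] bc].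
  split=> // y; rewrite !inE => /or3P[]/eqP->; apply: fintype.image_f; apply: sub;
    by rewrite !inE eqxx ?orbT.
suff : (r.+3.*2 <= d)%N by rewrite leqNgt dr.
apply: (@unit_multipartite_dim R d r.+3 (fun i => (g i).1.1) (fun i => (g i).1.2)
  (fun i => (g i).2)) => // [i ir|i j ir jr ij y z].
  by have [] := gP i ir.
have [_ _ _ gi] := gP i ir; have [_ _ _ gj] := gP j jr.
move=> /gi/fintype.imageP[a af ->] /gj/fintype.imageP[b bf ->]; apply/eqP; rewrite -xP.
exact: (fe i j).
Qed.

Lemma card_supersets (U : finType) (Q : {set U}) :
  (#|[set G : {set U} | Q \subset G]| * 2 ^ #|Q| <= 2 ^ #|U|)%N.
Proof.
have inj : {in [set G : {set U} | Q \subset G] &, injective (fun G => G :\: Q)}.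
  move=> G H; rewrite !inE => /finset.setIidPr QG /finset.setIidPr QH e.
  by rewrite -(finset.setID G Q) -(finset.setID H Q) QG QH e.
rewrite -(card_in_imset inj) -[in leqRHS](cardsC Q) addnC expnD leq_mul //.
rewrite -card_powerset; apply: subset_leq_card.
apply/fintype.subsetP => _ /imsetP[G _ ->]; rewrite inE finset.setDE.
exact: finset.subsetIr.
Qed.

Lemma card_disjoint_sets (U : finType) (Q : {set U}) :
  (#|[set G : {set U} | [disjoint Q & G]]| * 2 ^ #|Q| <= 2 ^ #|U|)%N.
Proof.
rewrite -[in leqRHS](cardsC Q) addnC expnD leq_mul // -card_powerset.
apply: subset_leq_card; apply/fintype.subsetP => G; rewrite !inE.
by rewrite disjoint_sym finset.disjoints_subset.
Qed.

(** The first moment method for two-colourings: a uniform random [G] contains, or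
    misses, a given set of size at least [q] with probability at most
    [2 / 2 ^ q]. *)
Lemma property_B (U J : finType) (K : {set J}) (Q : J -> {set U}) (q : nat) :
  {in K, forall j, (q <= #|Q j|)%N} -> (2 * #|K| < 2 ^ q)%N ->
  exists G : {set U}, {in K, forall j, ~~ (Q j \subset G) && ~~ [disjoint Q j & G]}.
Proof.
move=> Qq Ksmall.
pose bad j :=
  [set G : {set U} | Q j \subset G] :|: [set G : {set U} | [disjoint Q j & G]].
have cbad j : j \in K -> (#|bad j| * 2 ^ q <= 2 * 2 ^ #|U|)%N.
  move=> /Qq qQ; apply: (@leq_trans (#|bad j| * 2 ^ #|Q j|)).
    by rewrite leq_mul2l leq_exp2l // qQ orbT.
  rewrite mul2n -addnn.
  apply: leq_trans (leq_add (card_supersets (Q j)) (card_disjoint_sets (Q j))).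
  by rewrite -mulnDl leq_mul2r leq_card_setU orbT.
have cbads : (#|\bigcup_(j in K) bad j| * 2 ^ q <= 2 * #|K| * 2 ^ #|U|)%N.
  apply: (@leq_trans ((\sum_(j in K) #|bad j|) * 2 ^ q)).
    rewrite leq_mul2r; apply/orP; right.
    exact: leq_card_bigcup.
  rewrite big_distrl /= mulnAC mulnC -sum_nat_const.
  by apply: leq_sum => j /cbad; rewrite mulnC.
have : (#|\bigcup_(j in K) bad j| < #|{set U}|)%N.
  rewrite -(ltn_pmul2r (m := 2 ^ q)) ?expn_gt0 //.
  apply: leq_ltn_trans cbads _.
  have -> : #|{set U}| = (2 ^ #|U|)%N.
    by rewrite -(finset.cardsT U) -card_powerset finset.powersetT finset.cardsT.
  by rewrite mulnC ltn_pmul2l ?expn_gt0.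
rewrite ltnNge -finset.cardsT => /negP cT.
have [G Gbad] : exists G, G \notin \bigcup_(j in K) bad j.
  apply/existsP; apply: contra_notT cT => /existsPn all_bad.
  apply: subset_leq_card; apply/fintype.subsetP => G _.
  by have := all_bad G; rewrite negbK.
exists G => j jK; rewrite -negb_or; apply: contra Gbad => GQ.
by apply/bigcupP; exists j => //; rewrite !inE.
Qed.

(** Each pair of distinct nonadjacent vertices is listed in both orders. *)
Definition nonadjacent (s : nat) (P : {set 'I_s * 'I_s}) : {set 'I_s * 'I_s} :=
  [set p | (p.1 != p.2) && (p \notin P)].

Lemma card_nonadjacent (s : nat) (P : {set 'I_s * 'I_s}) :
  (s * s <= #|nonadjacent P| + (s + #|P|))%N.
Proof.
have -> : (s * s = #|nonadjacent P| + #|~: nonadjacent P|)%N.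
  by rewrite cardsC card_prod card_ord.
rewrite leq_add2l.
have diag : #|[set (i, i) | i in 'I_s]| = s.
  by rewrite card_imset ?card_ord // => i j [].
rewrite -[X in (_ <= X + _)%N]diag.
apply: leq_trans (leq_card_setU _ _); apply: subset_leq_card.
apply/fintype.subsetP => -[i j]; rewrite !inE negb_and !negbK /=.
by case/orP => [/eqP->|->]; rewrite ?orbT // imset_f.
Qed.

Definition pair_images (n s : nat) (phi : 'I_s -> 'I_n) (X : {set 'I_s * 'I_s}) :
  {set {set 'I_n}} := [set [set phi p.1; phi p.2] | p in X].

Lemma card_pair_images (n s : nat) (phi : 'I_s -> 'I_n) (X : {set 'I_s * 'I_s}) :
  injective phi -> (#|X| <= #|pair_images phi X| * 2)%N.
Proof.
move=> inj; rewrite -sum1_card -sum_nat_const.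
rewrite (partition_big_imset (fun p => [set phi p.1; phi p.2])) /=.
apply: leq_sum => _ /imsetP[[i j] _ ->]; rewrite sum1dep_card /=.
(* a pair of vertices comes from at most two ordered pairs *)
apply: (@leq_trans #|[set (i, j); (j, i)]|); last by rewrite cards2; case: eqP.
apply: subset_leq_card; apply/fintype.subsetP => -[k l]; rewrite !inE /=.
case/andP => _ /eqP eq_pairs.
have ki : phi k \in [set phi i; phi j] by rewrite -eq_pairs !inE eqxx.
have li : phi l \in [set phi i; phi j] by rewrite -eq_pairs !inE eqxx orbT.
have ik : phi i \in [set phi k; phi l] by rewrite eq_pairs !inE eqxx.
have jk : phi j \in [set phi k; phi l] by rewrite eq_pairs !inE eqxx orbT.
move: ki li ik jk; rewrite !inE !(inj_eq inj).
move=> /orP[]/eqP-> /orP[]/eqP->; rewrite ?orbb => ij ji.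
- by rewrite (eqP ji) eqxx.
- by rewrite eqxx.
- by rewrite eqxx orbT.
- by rewrite (eqP ij) eqxx.
Qed.

(** Only the unit distances among the vertices are kept, since the missing edges
    alone enter the probabilistic estimate. *)
Lemma induced_distance_pattern (R : realType) (d s : nat) (T : finType) (e : rel T) :
  has_induced_distance_graph R d e s ->
  exists (phi : {ffun 'I_s -> T}) (P : {set 'I_s * 'I_s}),
    [/\ injective phi, P \in unit_patterns R d s &
        {in nonadjacent P, forall p, ~~ e (phi p.1) (phi p.2)}].
Proof.
move=> [A cA [V [E [[_ E1] [f [[fV finj _] fE]]]]]].
pose phi : {ffun 'I_s -> T} := [ffun i => enum_val (cast_ord (esym cA) i)].
have phiA i : phi i \in A by rewrite ffunE enum_valP.
have phi_inj : injective phi.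
  by move=> i j; rewrite !ffunE => /enum_val_inj/cast_ord_inj.
pose P := [set p : 'I_s * 'I_s | edist (f (phi p.1)) (f (phi p.2)) == 1].
exists phi, P; split=> //.
  rewrite inE; apply/asboolP; exists (f \o phi); split=> [i j /= eqf|i j].
    by apply/phi_inj/finj => //; rewrite inE; apply: phiA.
  by rewrite inE.
move=> p; rewrite !inE => /andP[_]; apply: contra.
by rewrite fE // => /E1[_ _ ->].
Qed.

(** Edges of a random graph on ['I_n] are modelled by a set [G] of pairs.  If
    the graph, or its complement, induces a distance graph on [s] vertices
    enumerated by [phi], then [G] misses, or contains, all the images under
    [phi] of the nonadjacent pairs of some unit distance pattern.  There are
    at least [q] such images, and [property_B] avoids all of them if the pairs
    made of an enumeration and a pattern are too few. *)
Lemma distance_ramsey_property_count (R : realType) (d s n q : nat) :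
  distance_ramsey_property R s s d n ->
  (forall P, P \in unit_patterns R d s -> 2 * q + s + #|P| <= s * s)%N ->
  (2 ^ q <= 2 * (n ^ s * (s * s * 2).+1 ^ (s * d)))%N.
Proof.
move=> ramsey sparse.
pose K := [set j : {ffun 'I_s -> 'I_n} * {set 'I_s * 'I_s} |
  injectiveb j.1 && (j.2 \in unit_patterns R d s)].
have cK : (#|K| <= n ^ s * (s * s * 2).+1 ^ (s * d))%N.
  apply: (@leq_trans #|finset.setX [set: {ffun 'I_s -> 'I_n}] (unit_patterns R d s)|).
    apply: subset_leq_card; apply/fintype.subsetP => -[phi P].
    by rewrite !inE => /andP[_ /asboolP].
  by rewrite cardsX cardsT card_ffun !card_ord leq_mul2l card_unit_patterns orbT.
rewrite leqNgt; apply/negP => small.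
pose Q (j : {ffun 'I_s -> 'I_n} * {set 'I_s * 'I_s}) :=
  pair_images j.1 (nonadjacent j.2).
have [||G GP] := @property_B _ _ K Q q.
- move=> [phi P]; rewrite inE /= => /andP[/injectiveP inj /sparse sP].
  have := card_nonadjacent P; have := card_pair_images (nonadjacent P) inj.
  by rewrite /Q /=; move: #|_| #|_| #|_| sP; lia.
- by apply: leq_ltn_trans small; rewrite leq_mul2l cK.
pose e : rel 'I_n := [rel x y | (x != y) && ([set x; y] \in G)].
have simple_e : simple_graph e.
  split=> [x y|x]; last by rewrite /e /= eqxx.
  by rewrite /e /= eq_sym finset.setUC.
case: (ramsey e simple_e) => /induced_distance_pattern[phi [P [inj PU Pe]]].
all: have jK : (phi, P) \in K by rewrite inE PU andbT; apply/injectiveP.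
all: have /andP[] := GP _ jK.
- move=> _ /negP[]; rewrite finset.disjoints_subset.
  apply/fintype.subsetP => _ /imsetP[p pX ->].
  have := Pe p pX; rewrite /e /= (inj_eq inj).
  by move: pX; rewrite !inE => /andP[-> _].
- move=> /negP[]; apply/fintype.subsetP => _ /imsetP[p pX ->].
  have := Pe p pX; rewrite /compl_graph /e /= (inj_eq inj).
  by move: pX; rewrite !inE => /andP[-> _]; rewrite negbK.
Qed.

(** * Asymptotics *)

(** From [s * s * 2 + 1 <= 3 * sqrt s ^ 4] and [ln x < x]. *)
Lemma ln_pattern_base_le (R : realType) (s : nat) : (0 < s)%N ->
  ln ((s * s * 2).+1%:R : R) <= 3 + 4 * Num.sqrt s%:R.
Proof.
move=> s0; have s0R : 0 < s%:R :> R by rewrite ltr0n.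
have q0 : 0 < Num.sqrt s%:R :> R by rewrite sqrtr_gt0.
apply: (@le_trans _ _ (ln (3 * Num.sqrt s%:R ^+ 4))).
  rewrite ler_ln ?posrE ?ltr0n // ?mulr_gt0 ?exprn_gt0 //.
  rewrite (exprM _ 2 2) sqr_sqrtr ?ler0n // -natrX -natrM ler_nat.
  by rewrite expnS expn1; nia.
rewrite lnM ?posrE ?exprn_gt0 // lnXn // -(mulr_natl (ln _)).
by apply: lerD; [|apply: ler_wpM2l => //]; apply: ltW; apply: ln_sublinear.
Qed.

Lemma sqrt_dominates (R : realType) (a b c : R) : 0 < a -> 0 <= b -> 0 <= c ->
  exists s0, forall s, (s0 <= s)%N -> b + c * Num.sqrt s%:R <= a * s%:R.
Proof.
move=> a0 b0 c0; have a20 : 0 < a / 2 by rewrite divr_gt0.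
have [s1 s1P] := eventually_nat_ge b a20.
have cc : 0 < (a / 2) ^+ 2 by rewrite exprn_gt0.
have [s2 s2P] := eventually_nat_ge (c ^+ 2) cc.
exists (maxn s1 s2) => s; rewrite geq_max => /andP[/s1P h1 /s2P h2].
have q0 : 0 <= Num.sqrt s%:R :> R by apply: sqrtr_ge0.
have sE : s%:R = Num.sqrt s%:R ^+ 2 :> R by rewrite sqr_sqrtr.
have h3 : c <= a / 2 * Num.sqrt s%:R.
  rewrite -ler_sqr ?nnegrE //; last by rewrite mulr_ge0 // ltW.
  by rewrite exprMn -sE.
have : c * Num.sqrt s%:R <= a / 2 * Num.sqrt s%:R * Num.sqrt s%:R.
  by apply: ler_wpM2r.
rewrite -mulrA -expr2 -sE => h4; lra.
Qed.

(** With [n] the Ramsey number, [distance_ramsey_property_count] applies with [q]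
    about [s ^ 2 * (1 / k - del) / 2], where [k = d %/ 2], and bounds [q * ln 2]
    by [s * ln n] plus an error of order [s * ln s].  Division by [s] gives the
    exponent [1 / (2 * k)]. *)
Lemma ln_distance_ramsey_ge (R : realType) (d : nat) (eps : R) :
  (4 <= d)%N -> 0 < eps ->
  exists s0, forall s, (s0 <= s)%N ->
    (0 < distance_ramsey R s s d)%N /\
    (1 / (2 * (d %/ 2)%N%:R) - eps) * s%:R * ln 2 <= ln (distance_ramsey R s s d)%:R.
Proof.
move=> d4 eps0.
have [r rE] : exists r, (d %/ 2 = r.+2)%N by exists (d %/ 2).-2; lia.
rewrite rE; pose k : R := r.+2%:R.
have k0 : 0 < k by rewrite ltr0n.
pose h := 1 / (2 * k).
have h0 : 0 < h by rewrite divr_gt0 // mulr_gt0.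
have kV : k^-1 = 2 * h by rewrite /h invfM mul1r mulrA divff ?mul1r.
(* the bound [del <= h] makes [y], the bound on [q], nonnegative *)
pose del := Num.min eps h.
have del0 : 0 < del by rewrite lt_min eps0.
have ln2 : 0 < ln 2 :> R by rewrite ln_gt0 // ltr1n.
have [s1 s1P] : exists s0, forall s, (s0 <= s)%N -> forall P,
    P \in unit_patterns R d s -> #|P|%:R <= (1 - k^-1 + del) * s%:R ^+ 2.
  by apply: card_unit_pattern_le => //; lia.
have [s2 s2P] := eventually_nat_ge 1 h0.
have [s3 s3P] : exists s0, forall s, (s0 <= s)%N ->
    (3 * ln 2 + 3 * d%:R) + (4 * d%:R) * Num.sqrt s%:R <= del * ln 2 / 2 * s%:R.
  apply: sqrt_dominates.
  - by rewrite divr_gt0 // mulr_gt0.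
  - by rewrite addr_ge0 ?mulr_ge0 // ltW.
  - by rewrite mulr_ge0.
exists (maxn (maxn 1 s1) (maxn s2 s3)) => s.
rewrite !geq_max => /andP[/andP[s_gt0 /s1P sparse] /andP[/s2P hs /s3P ds]].
have s1R : 1 <= s%:R :> R by rewrite ler1n.
have s0R : 0 < s%:R :> R by rewrite ltr0n.
pose y : R := s%:R * (s%:R * (2 * h - del) - 1) / 2.
have delh : del <= h by rewrite ge_min lexx orbT.
have y0 : 0 <= y.
  rewrite divr_ge0 // mulr_ge0 //.
  have : 0 <= s%:R * (h - del) by rewrite mulr_ge0 // subr_ge0.
  by lra.
pose q := Num.truncn y.
have /andP[qy yq] : (q%:R <= y) && (y < q.+1%:R) by apply: truncn_itv.
set n := distance_ramsey R s s d.
have [ramsey _] : distance_ramsey_min R s s d n.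
  by apply: distance_ramseyP; apply: leq_trans d4.
have count : (2 ^ q <= 2 * (n ^ s * (s * s * 2).+1 ^ (s * d)))%N.
  apply: (distance_ramsey_property_count ramsey) => P /sparse sP.
  rewrite -(ler_nat R) !(natrD, natrM).
  move: sP qy; rewrite kV /y expr2 => sP qy; lra.
have n0 : (0 < n)%N.
  rewrite lt0n; apply/eqP => n0; move: count.
  by rewrite n0 exp0n // mul0n muln0 leqNgt expn_gt0.
split=> //.
have n0R : 0 < n%:R :> R by rewrite ltr0n.
set p := (s * s * 2).+1 in count.
have p0R : 0 < p%:R :> R by rewrite ltr0n.
have lncount : q%:R * ln 2 <= ln 2 + (s%:R * ln n%:R + s%:R * d%:R * ln p%:R) :> R.
  have : ln (2 ^+ q) <= ln (2 * (n%:R ^+ s * p%:R ^+ (s * d))) :> R.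
    rewrite ler_ln ?posrE ?mulr_gt0 ?exprn_gt0 //.
    by rewrite -!natrX -!natrM ler_nat.
  rewrite lnM ?posrE ?mulr_gt0 ?exprn_gt0 // lnM ?posrE ?exprn_gt0 //.
  by rewrite !lnXn // -!(mulr_natl (ln _)) natrM.
have lnp := ln_pattern_base_le R s_gt0; rewrite -/p in lnp.
have deleps : del <= eps by rewrite ge_min lexx.
apply: (@le_trans _ _ ((h - del) * s%:R * ln 2)).
  by rewrite ler_pM2r // ler_pM2r //; exact: lerB (lexx h) deleps.
rewrite -(ler_pM2l s0R).
have A1 : y * ln 2 <= (q%:R + 1) * ln 2.
  by rewrite ler_pM2r //; move: yq; rewrite -[q.+1]addn1 natrD => /ltW.
have A2 : s%:R * (d%:R * ln p%:R) <= s%:R * (d%:R * (3 + 4 * Num.sqrt s%:R)) :> R.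
  by rewrite ler_pM2l // ler_wpM2l.
have A3 := ler_wpM2l (ltW s0R) ds.
have A4 : ln 2 <= s%:R * ln 2 :> R by rewrite ler_pMl.
rewrite /y in A1.
move: (Num.sqrt s%:R : R) (ln p%:R : R) (ln n%:R : R) (ln 2 : R) (s%:R : R)
  (d%:R : R) (q%:R : R) A1 A2 A3 A4 lncount ln2 => u P N L S D X A1 A2 A3 A4 A5 L0.
clear -A1 A2 A3 A4 A5 L0; clearbody h del; lra.
Qed.

Local Open Scope classical_set_scope.

Theorem theorem4 (R : realType) (d : nat) (hd : (4 <= d)%N) :
  exists o : nat -> R, o @ \oo --> (0 : R) /\
    \forall s \near \oo,
      2 `^ ((1 / (2 * (d %/ 2)%N%:R) - o s) * s%:R)
        <= (distance_ramsey R s s d)%:R.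
Proof.
pose n s : R := (distance_ramsey R s s d)%:R.
pose h : R := 1 / (2 * (d %/ 2)%N%:R).
have ln2 : 0 < ln 2 :> R by rewrite ln_gt0 // ltr1n.
(* The function [o] is the defect of the exponent, cut off at 0: an upper bound
   on the Ramsey number is then unnecessary for its convergence. *)
pose o s : R := Num.max 0 (h - ln (n s) / (s%:R * ln 2)).
exists o; split.
  apply/cvgrPdist_le => eps eps0.
  have [s0 s0P] := ln_distance_ramsey_ge hd eps0.
  exists (maxn 1 s0) => // s /=; rewrite geq_max => /andP[s_gt0 /s0P[_ lnn]].
  have sl0 : 0 < s%:R * ln 2 :> R by rewrite mulr_gt0 ?ltr0n.
  rewrite sub0r normrN ger0_norm ?le_max ?lexx // ge_max (ltW eps0) /=.
  by rewrite lerBlDr -lerBlDl ler_pdivlMr // mulrA.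
have [s0 s0P] := ln_distance_ramsey_ge hd (@ltr01 R).
exists (maxn 1 s0) => // s /=; rewrite geq_max => /andP[s_gt0 /s0P[n0 _]].
have sl0 : 0 < s%:R * ln 2 :> R by rewrite mulr_gt0 ?ltr0n.
have n0R : 0 < n s by rewrite ltr0n.
rewrite -[leRHS]lnK ?posrE // /powR pnatr_eq0 /= ler_expR -mulrA -ler_pdivlMr //.
by rewrite lerBlDr -lerBlDl le_max lexx orbT.
Qed.
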